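(* Let $X$ be a locally compact Hausdorff space, let $k:X\times X\to[0,+\infty]$ be a nonnegative, lower semicontinuous, symmetric kernel, and let $\emptyset\neq K\subset L\subset X$ be arbitrary sets. Assume that $$W_k(\mu-\nu):=\int_X\int_X k(x,y)\,d(\mu-\nu)(x)\,d(\mu-\nu)(y)\ \ge 0\qquad\text{for all }\mu,\nu\in\mathfrak{M}_1(X)$$ (in particular these integrals are well defined), and that $A(K,L)=\{a(K,L)\}$ consists of a single point $a(K,L)$. If there is a probability measure $\mu_0\in\mathfrak{M}_1(K)$ which is $k$-invariant on $L$, then $a(K,L)=w(K)$, and $U^{\mu_0}(x)=w(K)$ for all $x\in L$.
   Context: $\mathfrak{M}_1(X)$ denotes the set of regular Borel probability measures on $X$. For $E\subset X$, $\mathfrak{M}_1(E)$ is the set of $\mu\in\mathfrak{M}_1(X)$ such that $E$ is $\mu$-measurable and $\mu(E)=\mu(X)=1$. The kernel $k$ is symmetric if $k(x,y)=k(y,x)$ for all $x,y\in X$; lower semicontinuity is meant as a function on $X\times X$. The potential and the energy of $\mu\in\mathfrak{M}_1(X)$ are $$U^{\mu}(x):=\int_X k(x,y)\,d\mu(y),\qquad W(\mu):=\int_X\int_X k(x,y)\,d\mu(y)\,d\mu(x),$$ with values in $[0,+\infty]$. The Wiener energy of a set $E\subset X$ is $w(E):=\inf_{\mu\in\mathfrak{M}_1(E)}W(\mu)$. A measure $\mu\in\mathfrak{M}_1(K)$ is called $k$-invariant on $L$ if $U^{\mu}$ is constant on $L$. The average set of $L$ with respect to $K$ is $$A(K,L):=\bigcap_{\mu\in\mathfrak{M}_1(K)}\Bigl[\inf_{x\in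 L}U^{\mu}(x),\ \sup_{x\in L}U^{\mu}(x)\Bigr]\subset[0,+\infty],$$ the intervals being closed intervals in $[0,+\infty]$. *)

(* Defs.v *)
From mathcomp Require Import all_boot all_order all_algebra.
From mathcomp Require Import all_classical all_reals all_analysis.
From mathcomp Require Import measurable_realfun.

Set Implicit Arguments.
Unset Strict Implicit.
Unset Printing Implicit Defensive.

Import Order.TTheory GRing.Theory Num.Theory.
Import numFieldNormedType.Exports.

Local Open Scope classical_set_scope.
Local Open Scope ring_scope.
Local Open Scope ereal_scope.

Notation borel X := (g_sigma_algebraType (@open X)).

Section Measures.
Context {R : realType} {X : ptopologicalType}.

Definition regular_measure (mu : {measure set (borel X) -> \bar R}) : Prop :=
  forall A : set (borel X), measurable A ->
    mu A = ereal_sup [set mu C | C in [set C : set X | compact C /\ C `<=` A]] /\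
    mu A = ereal_inf [set mu U | U in [set U : set X | open U /\ A `<=` U]].

Definition M1 : set (probability (borel X) R) :=
  [set mu | regular_measure mu].

(* E need not be Borel: mu-measurability refers to the completion of mu, whose
   value on such an E is given by the outer measure mu^*. *)
Definition M1_on (E : set X) : set (probability (borel X) R) :=
  [set mu | [/\ M1 mu, completed_algebra_gen mu E & mu_ext mu E = 1]].

End Measures.

Section SignedIntegral.
Context d {T : measurableType d} {R : realType}.
Variable sigma : {charge set T -> \bar R}.

(* The Jordan decomposition does not depend on the chosen Hahn decomposition
   (see Hahn_decomposition_uniq). *)
Definition pos_part : {measure set T -> \bar R} :=
  jordan_pos (projT2 (cid (projT2 (cid (Hahn_decomposition sigma))))).

Definition neg_part : {measure set T -> \bar R} :=
  jordan_neg (projT2 (cid (projT2 (cid (Hahn_decomposition sigma))))).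

(* Existence of the integral in [-oo, +oo]: no oo - oo occurs. *)
Definition signed_integral_defined (f : T -> \bar R) : Prop :=
  measurable_fun [set: T] f /\
  (\int[pos_part]_x f^\+ x + \int[neg_part]_x f^\- x)
    +? - (\int[pos_part]_x f^\- x + \int[neg_part]_x f^\+ x).

Definition signed_integral (f : T -> \bar R) : \bar R :=
  \int[pos_part]_x f x - \int[neg_part]_x f x.

End SignedIntegral.

Section Energy.
Context {R : realType} {X : ptopologicalType}.
Variable k : X * X -> \bar R.

Definition potential (mu : {measure set (borel X) -> \bar R}) (x : X) : \bar R :=
  \int[mu]_y k (x, y).

Definition energy (mu : {measure set (borel X) -> \bar R}) : \bar R :=
  \int[mu]_x \int[mu]_y k (x, y).

Definition wiener_energy (E : set X) : \bar R :=
  ereal_inf [set energy mu | mu in M1_on E].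

Definition invariant_on (L : set X) (mu : {measure set (borel X) -> \bar R}) :=
  exists c : \bar R, forall x, L x -> potential mu x = c.

Definition average_set (K L : set X) : set (\bar R) :=
  [set a | 0 <= a] `&`
  \bigcap_(mu in M1_on K)
    [set a | ereal_inf (potential mu @` L) <= a <= ereal_sup (potential mu @` L)].

Definition difference (mu nu : probability (borel X) R) :
    {charge set (borel X) -> \bar R} :=
  cadd (charge_of_finite_measure mu) (copp (charge_of_finite_measure nu)).

Definition signed_potential (sigma : {charge set (borel X) -> \bar R})
    (y : X) : \bar R :=
  signed_integral sigma (fun x => k (x, y)).

Definition signed_energy (sigma : {charge set (borel X) -> \bar R}) : \bar R :=
  signed_integral sigma (signed_potential sigma).

(* The inner integral has to exist for |sigma|-almost every y only. *)
Definition signed_energy_defined (sigma : {charge set (borel X) -> \bar R}) :=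
  [/\ {ae pos_part sigma,
        forall y : borel X, signed_integral_defined sigma (fun x => k (x, y))},
      {ae neg_part sigma,
        forall y : borel X, signed_integral_defined sigma (fun x => k (x, y))} &
      signed_integral_defined sigma (signed_potential sigma)].

End Energy.

(* Main.v *)
Require Import Defs.
From mathcomp Require Import all_boot all_order all_algebra finmap.
From mathcomp Require Import all_classical all_reals all_analysis.
From mathcomp Require Import measurable_realfun lra.
Import Order.TTheory GRing.Theory Num.Theory.
Import numFieldNormedType.Exports.
Local Open Scope classical_set_scope.
Local Open Scope ring_scope.
Local Open Scope ereal_scope.

(** Write E(mu, nu) for the mutual energy, the integral of the potential of nu
    against mu, and let c be the value of the potential of mu0 on L.  The
    interval that mu0 contributes to the average set is [c, c], so a = c; and
    as mu0 lives on K, where its potential is c, its energy is c, so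
    w(K) <= c.  What remains is that every mu on K has energy at least c.

    If c is finite and W(mu) is finite, expand the positivity hypothesis:
      0 <= W(mu - mu0) = W(mu) - 2 E(mu, mu0) + W(mu0) = W(mu) - 2 c + c
    ([signed_energy_difference], [invariant_potential_le_energy]).  Two points
    need work.  First, E has to be symmetric, although a lower semicontinuous
    kernel on X * X need not be measurable for the product of the Borel
    sigma-algebras, so that Tonelli does not apply to k itself.  Regularity
    replaces that measurability: a simple function below a potential can be
    taken with compact level sets ([compact_level_nnsfun]), and compactness
    then yields a product-measurable minorant of k whose partial integrals
    are still above that simple function; Tonelli applies to the minorant
    ([le_mutual_energyC]).  The same construction makes potentials lower
    semicontinuous, hence Borel ([potential_lsc]).  Secondly, the signed
    energy is defined by the Jordan parts p and n of mu - mu0, and is brought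
    back to mu and mu0 through p + mu0 = n + mu, p <= mu and n <= mu0.

    If c is infinite, a measure mu on K of finite energy is excluded as follows
    ([infinite_potential_infinite_energy]).  When mu' is mutually singular
    to nu' and W(mu') is finite, the Jordan parts of mu' - nu' are mu' and nu'
    themselves, and E(mu', nu') = +oo would make the signed energy -oo
    ([singular_mutual_energy]); so E(mu', nu') is finite.  Take a Hahn
    decomposition P, N of mu - mu0, and condition mu to P and mu0 to N; the
    results alpha and beta are mutually singular and W(alpha) is finite.
    Since mu0 <= mu on P, we have mu0 <= mu + beta and therefore
      E(alpha, mu0) <= E(alpha, mu) + E(alpha, beta) < +oo,
    whereas the potential of mu0 is infinite alpha-almost everywhere. *)

(** * Regular Borel measures *)

Section Regularity.
Set Implicit Arguments.
Unset Strict Implicit.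
Context {R : realType} {X : ptopologicalType}.
Implicit Types (mu nu : {measure set (borel X) -> \bar R}).

Lemma open_borel (U : set X) : open U -> measurable (U : set (borel X)).
Proof. by move=> oU; exact: sub_sigma_algebra. Qed.

Hypothesis hX : hausdorff_space X.

Lemma compact_borel (C : set X) : compact C -> measurable (C : set (borel X)).
Proof.
move=> cC; rewrite -[C]setCK; apply: measurableC; apply: open_borel.
by apply: closed_openC; exact: compact_closed.
Qed.

(** For finite measures this is equivalent to regularity.  Unlike the two
    extremal formulas that define the latter, it passes at once to every
    measure dominated by a multiple of [mu], such as a Jordan part or a
    conditional measure. *)
Definition compact_open_approximable mu :=
  forall A : set (borel X), measurable A -> forall e : R, (0 < e)%R ->
  exists C U : set X,
    [/\ compact C, open U, C `<=` A, A `<=` U & mu (U `\` C) <= e%:E].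

Lemma regular_approximable mu : fin_num_fun mu ->
  regular_measure mu -> compact_open_approximable mu.
Proof.
move=> fmu rmu A mA e e0; have e20 : (0 < e / 2)%R by rewrite divr_gt0.
have finA : mu A \is a fin_num by exact: fmu.
have [supA infA] := rmu A mA.
move: (finA) (finA).
rewrite [X in X \is a _ -> _]supA [X in _ -> X \is a _ -> _]infA.
move=> /(ub_ereal_sup_adherent e20); rewrite -supA => -[_ [C [cC CA] <-] CA'].
move=> /(lb_ereal_inf_adherent e20); rewrite -infA => -[_ [U [oU AU] <-] UA].
exists C, U; split=> //.
have mC := compact_borel cC; have mU := open_borel oU.
have gap : mu U - mu C <= e%:E.
  move: UA CA'; rewrite -(fineK finA) -(fineK (fmu _ mU)) -(fineK (fmu _ mC)).
  by rewrite -!EFinD !lte_fin lee_fin => h1 h2; lra.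
rewrite measureD//; last by rewrite ltey_eq fmu.
by have -> : U `&` C = C by apply/setIidr; exact: subset_trans AU.
Qed.

Lemma approximable_regular mu :
  compact_open_approximable mu -> regular_measure mu.
Proof.
move=> amu A mA; split; apply/eqP; rewrite eq_le; apply/andP; split.
- apply/lee_addgt0Pr => e e0; have [C [U [cC oU CA AU muUC]]] := amu A mA e e0.
  have mC := compact_borel cC; have mU := open_borel oU.
  apply: (@le_trans _ _ (mu C + mu (U `\` C))).
    rewrite -measureU//; last 2 first.
    + exact: measurableD.
    + by rewrite setDE setICA setICr setI0.
    by rewrite setDUK; [apply: le_measure; rewrite ?inE|exact: subset_trans AU].
  by apply: leeD => //; apply: ereal_sup_ubound; exists C.
- apply: ge_ereal_sup => _ [C [cC CA] <-].
  by apply: le_measure; rewrite ?inE//; exact: compact_borel.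
- apply: le_ereal_inf_tmp => _ [U [oU AU] <-].
  by apply: le_measure; rewrite ?inE//; exact: open_borel.
- apply/lee_addgt0Pr => e e0; have [C [U [cC oU CA AU muUC]]] := amu A mA e e0.
  have mC := compact_borel cC; have mU := open_borel oU.
  apply: (@le_trans _ _ (mu C + mu (U `\` C))).
    rewrite -measureU//; last 2 first.
    + exact: measurableD.
    + by rewrite setDE setICA setICr setI0.
    rewrite setDUK; last exact: subset_trans AU.
    by apply: ereal_inf_lbound; exists U.
  by apply: leeD => //; apply: le_measure; rewrite ?inE.
Qed.

Lemma dominated_approximable mu nu (c : R) :
  (0 < c)%R -> (forall A, measurable A -> nu A <= c%:E * mu A) ->
  compact_open_approximable mu -> compact_open_approximable nu.
Proof.
move=> c0 numu amu A mA e e0.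
have ce0 : (0 < c^-1 * e)%R by rewrite mulr_gt0// invr_gt0.
have [C [U [cC oU CA AU muUC]]] := amu A mA _ ce0.
exists C, U; split=> //; apply: le_trans (numu _ _) _.
  by apply: measurableD; [exact: open_borel|exact: compact_borel].
by rewrite -lee_pdivlMl.
Qed.

Import HBNNSimple.

(** The form in which inner regularity is used: below an integral there is a
    simple function to which compactness can be applied level by level.  The
    strict inequality is what persists on a neighbourhood when [f] is a section
    of a lower semicontinuous kernel. *)
Lemma compact_level_nnsfun mu (f : borel X -> \bar R) (t : \bar R) :
  compact_open_approximable mu -> (forall x, 0 <= f x) ->
  t < \int[mu]_x f x -> exists g : {nnsfun borel X >-> R},
    [/\ forall v, (0 < v)%R -> compact (g @^-1` [set v] : set X),
        forall x, (0 < g x)%R -> (g x)%:E < f x &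
        t < \int[mu]_x (g x)%:E].
Proof.
move=> amu f0; rewrite ge0_integralTE// => /ereal_sup_gt[_ [/= g gf <-] tg].
(* Shrinking by a factor r < 1 buys the strict inequality. *)
have [r [r01 tr]] : exists r : R, (0 < r < 1)%R /\ t < r%:E * sintegral mu g.
  apply: contrapT => /forallNP H; move: tg; apply/negP; rewrite -leNgt.
  apply/lee_mul01Pr; first exact: sintegral_ge0.
  by move=> r r01; rewrite leNgt; apply/negP => h; apply: (H r).
have /andP[r0 r1] := r01.
pose g1 := scale_nnsfun g (ltW r0).
have g1E x : g1 x = (r * g x)%R by [].
have {}tr : t < \int[mu]_x (g1 x)%:E.
  by rewrite integral_nnsfun// patch_setT -sintegralrM in tr *.
have [e [e0 te]] : exists e : R, (0 < e)%R /\ t + e%:E < \int[mu]_x (g1 x)%:E.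
  apply: contrapT => /forallNP H; move: tr; apply/negP; rewrite -leNgt.
  apply/lee_addgt0Pr => e e0.
  by rewrite leNgt; apply/negP => h; apply: (H e).
have [B [B0 g1B]] : exists B : R, (0 < B)%R /\ forall x, (g1 x <= B)%R.
  have [M [_ /(_ (Num.max (M + 1) 1)%R)]] := simple_bounded g1.
  rewrite lt_max ltrDl ltr01/= => /(_ isT) gM.
  exists (Num.max (M + 1) 1)%R; split; first by rewrite lt_max ltr01 orbT.
  by move=> x; rewrite (le_trans (ler_norm _))//; exact: gM.
(* Each of the finitely many level sets loses mass at most del when it is
   replaced by a compact subset; del makes the total loss of the integral of
   g1 <= B at most e.  The successor avoids a division by zero. *)
pose D := range g1; have finD : finite_set D by exact: fimfunP.
pose n : nat := size (fset_set D).
pose del : R := (e / B / n.+1%:R)%R.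
have del0 : (0 < del)%R by rewrite !divr_gt0.
have /choice[C HC] : forall v, exists C : set X,
    [/\ compact C, C `<=` g1 @^-1` [set v] &
     mu (g1 @^-1` [set v] `\` C) <= del%:E].
  move=> v; have [|C [U [cC oU CA AU muUC]]] := amu (g1 @^-1` [set v]) _ _ del0.
    by [].
  have mC := compact_borel cC; have mU := open_borel oU.
  exists C; split=> //; apply: le_trans muUC; apply: le_measure; rewrite ?inE.
  - exact: measurableD.
  - exact: measurableD.
  - exact: setSD.
pose F : set (borel X) := \bigcup_(v in D) C v.
have mC v : measurable (C v : set (borel X)).
  by apply: compact_borel; have [] := HC v.
have mF : measurable F by exact: fin_bigcup_measurable.
have muF : B%:E * mu (~` F) <= e%:E.
  rewrite -lee_pdivlMl//.
  have : mu (~` F) <= \sum_(v \in D) mu (g1 @^-1` [set v] `\` C v).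
    apply: content_sub_fsum => //; first by move=> v _; exact: measurableD.
    + exact: measurableC.
    + by move=> x Fx; exists (g1 x); [exists x|split=> //= Cx; apply: Fx;
        exists (g1 x) => //; exists x].
  move/le_trans; apply.
  apply: (@le_trans _ _ (\sum_(v \in D) del%:E)).
    by apply: lee_fsum => // v _; have [] := HC v.
  rewrite fsbig_finite//= sumEFin lee_fin big_const_seq count_predT iter_addr_0.
  rewrite -/n -mulr_natr /del mulrC [leRHS]mulrC.
  by rewrite mulrCA ler_piMr// ?ler_pdivrMr ?mul1r ?ler_nat// divr_ge0// ltW.
exists (proj_nnsfun g1 mF).
have g2E x : proj_nnsfun g1 mF x = (g1 x * \1_F x)%R by [].
split.
- move=> v v0; have [cC Cg _] := HC v.
  suff -> : proj_nnsfun g1 mF @^-1` [set v] = C v by [].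
  apply/seteqP; split=> x /=; rewrite mindicE.
    case: (boolP (x \in F)) => [|_]; last first.
      by rewrite mulr0 => v0'; move: v0; rewrite -v0' ltxx.
    rewrite inE => -[w _ Cwx]; rewrite mulr1 => <-.
    by have [_ /(_ _ Cwx) /= -> _] := HC w.
  move=> Cx; have /= gx := Cg _ Cx.
  by rewrite mem_set ?mulr1//; exists v => //; exists x.
- move=> x; rewrite g2E indicE; case: (x \in F); last by rewrite mulr0 ltxx.
  rewrite mulr1 g1E pmulr_rgt0// => gx; apply: lt_le_trans (gf x).
  by rewrite lte_fin gtr_pMl.
- have fine_e : e%:E \is a fin_num by [].
  rewrite -(lteD2rE _ _ fine_e); apply: (lt_le_trans te).
  apply: (@le_trans _ _ (\int[mu]_x ((proj_nnsfun g1 mF x)%:E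
                          + B%:E * (\1_(~` F) x)%:E))).
    apply: ge0_le_integral => //.
    + by move=> x _; rewrite lee_fin.
    + exact/measurable_EFinP.
    + apply: emeasurable_funD; first exact/measurable_EFinP.
      apply: measurable_funeM; apply/measurable_EFinP.
      by apply: measurable_indic; exact: measurableC.
    + move=> x _; rewrite g2E !indicE in_setC.
      case: (x \in F) => /=; first by rewrite mulr1 mule0 adde0.
      by rewrite mulr0 add0e mule1 lee_fin; exact: g1B.
  rewrite ge0_integralD//; last 4 first.
  + by move=> x _; rewrite lee_fin.
  + exact/measurable_EFinP.
  + by move=> x _; rewrite mule_ge0// lee_fin// ltW.
  + apply: measurable_funeM; apply/measurable_EFinP.
    by apply: measurable_indic; exact: measurableC.
  apply: leeD => //.
  rewrite ge0_integralZl//; last 2 first.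
  + apply/measurable_EFinP.
    by apply: measurable_indic; exact: measurableC.
  + by rewrite lee_fin ltW.
  by rewrite integral_indic ?setIT//; exact: measurableC.
Qed.
End Regularity.

(** * Potentials and mutual energies of a lower semicontinuous kernel *)

Section LowerSemicontinuousKernel.
Set Implicit Arguments.
Unset Strict Implicit.
Context {R : realType} {X : ptopologicalType}.
Hypothesis hX : hausdorff_space X.

Lemma lower_semicontinuous_borel (f : X -> \bar R) :
  lower_semicontinuous f -> measurable_fun [set: borel X] f.
Proof.
move=> lscf; apply: (measurability _ (ErealGenOInfty.measurableE R)).
move=> /= _ [_ [a ->]] <-; apply: measurableI => //; apply: open_borel.
by rewrite preimage_itvoy; move/lower_semicontinuousP : lscf; exact.
Qed.

Variable k : X * X -> \bar R.
Hypothesis k_ge0 : forall z, 0 <= k z.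
Hypothesis k_lsc : lower_semicontinuous k.

Lemma kernel_section_lsc x : lower_semicontinuous (fun y => k (x, y)).
Proof.
move=> y a /k_lsc [V [[A B] /= [xA yB] ABV] Vk].
by exists B => // z Bz; apply: Vk; apply: ABV; split=> //=; exact: nbhs_singleton.
Qed.

Lemma kernel_section_borel x :
  measurable_fun [set: borel X] (fun y => k (x, y)).
Proof. by apply: lower_semicontinuous_borel; exact: kernel_section_lsc. Qed.

Lemma potential_ge0 (mu : {measure set (borel X) -> \bar R}) x :
  0 <= potential k mu x.
Proof. by apply: integral_ge0. Qed.

(** Tonelli applies to these functions, whereas [k] itself need not be
    measurable for the product of the two Borel sigma-algebras. *)
Definition product_minorant (h : borel X * borel X -> \bar R) :=
  [/\ measurable_fun setT h, forall z, 0 <= h z & forall z, h z <= k z].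

Lemma product_minorant_section h x : product_minorant h ->
  measurable_fun [set: borel X] (fun y => h (x, y)).
Proof. by case=> mh _ _; exact: (measurableT_comp mh (pair1_measurable x)). Qed.

Lemma le_potential_minorant (mu : {measure set (borel X) -> \bar R}) h x :
  product_minorant h -> \int[mu]_y h (x, y) <= potential k mu x.
Proof.
move=> hh; have [_ h0 hk] := hh; apply: ge0_le_integral => //.
- exact: product_minorant_section.
- exact: kernel_section_borel.
Qed.

Import HBNNSimple.

(** The minorant is [g y * \1_U x], where [g] is a simple function below
    [k (x0, _)] with compact level sets: by the tube lemma each of the finitely
    many inequalities [v < k (x, y)] on [{x0} * g^-1(v)] persists for [x] in a
    neighbourhood of [x0], and [U] is the interior of their intersection. *)
Lemma local_product_minorant (mu : {measure set (borel X) -> \bar R}) x0 t :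
  compact_open_approximable mu -> t < potential k mu x0 ->
  exists2 h, product_minorant h & \forall x \near x0, t < \int[mu]_y h (x, y).
Proof.
move=> amu /(compact_level_nnsfun hX amu (fun y => k_ge0 (x0, y)))[g [cg gk tg]].
pose D := fset_set (range g).
have near_k v : v \in D ->
    \forall x \near x0, (0 < v)%R -> forall y, g y = v -> v%:E < k (x, y).
  move=> _; have [v0|v0] := boolP (0 < v)%R; last exact: nearW.
  suff : \forall x \near x0, g @^-1` [set v] `<=` [set y | v%:E < k (x, y)].
    by apply: filterS => x gvk _ y /gvk.
  have /compact_near_coveringP := cg v v0; apply => y /= gyv.
  have : v%:E < k (x0, y) by rewrite -gyv; apply: gk; rewrite gyv.
  move=> /k_lsc [V [[A B] /= [xA yB] ABV] Vk].
  exists (B, A) => //= -[y' x'] [/= By' Ax'].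
  by apply: Vk; apply: ABV.
have := filter_bigI (nbhs_filter x0) near_k; set W := (X in nbhs x0 X) => x0W.
pose U : set (borel X) := interior W.
have mU : measurable U by apply: open_borel; exact: open_interior.
pose h (z : borel X * borel X) : \bar R := (g z.2 * \1_U z.1)%:E.
have hh : product_minorant h.
  split.
  - apply/measurable_EFinP; apply: measurable_funM.
      exact: measurableT_comp.
    by apply: measurableT_comp => //; exact: measurable_indic.
  - by move=> z; rewrite lee_fin mulr_ge0.
  - move=> [x y]; rewrite /h /= indicE.
    have [|_] := boolP (x \in U); last by rewrite mulr0.
    rewrite mulr1 inE => /interior_subset Wx.
    have : (0 <= g y)%R by []; rewrite le_eqVlt => /predU1P[<-//|gy0]; apply: ltW.
    by apply: (Wx (g y)) => //=; rewrite in_fset_set ?inE.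
exists h => //.
have : \forall x \near x0, interior W x by exact: nbhs_interior.
apply: filterS => x Ux; apply: (lt_le_trans tg); apply: ge0_le_integral => //.
- by move=> y _; rewrite lee_fin.
- exact/measurable_EFinP.
- exact: product_minorant_section.
- by move=> y _; rewrite /h /= indicE mem_set// mulr1.
Qed.

Lemma potential_lsc (mu : {measure set (borel X) -> \bar R}) :
  compact_open_approximable mu -> lower_semicontinuous (potential k mu).
Proof.
move=> amu x0 a /(local_product_minorant amu)[h hh near_h].
exists [set x | a%:E < \int[mu]_y h (x, y)] => // x /= /lt_le_trans; apply.
exact: le_potential_minorant.
Qed.

Lemma potential_borel (mu : {measure set (borel X) -> \bar R}) :
  compact_open_approximable mu ->
  measurable_fun [set: borel X] (potential k mu).
Proof. by move=> amu; apply: lower_semicontinuous_borel; exact: potential_lsc. Qed.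

(** Minorants are directed upwards by pointwise maximum.  Reading this as a
    filter lets the near-covering form of compactness choose one minorant for
    a whole compact set at once. *)
Definition large_minorants : set_system (borel X * borel X -> \bar R) :=
  filter_from product_minorant
    (fun h => [set h' | product_minorant h' /\ forall z, h z <= h' z]).

Lemma product_minorant0 : product_minorant (cst 0).
Proof. by split=> // z; exact: k_ge0. Qed.

#[local] Instance large_minorants_filter : ProperFilter large_minorants.
Proof.
apply: filter_from_proper; last by move=> h hh; exists h; split.
apply: filter_from_filter; first by exists (cst 0); exact: product_minorant0.
move=> h1 h2 [m1 h10 h1k] [m2 h20 h2k]; exists (fun z => maxe (h1 z) (h2 z)).
  split; first exact: measurable_maxe.
  - by move=> z; rewrite le_max h10.
  - by move=> z; rewrite ge_max h1k h2k.
by move=> h [hh le_h]; split; split=> // z; apply: le_trans (le_h z);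
  rewrite le_max lexx ?orbT.
Qed.

(** A strict lower bound of a potential on a compact set is already witnessed,
    uniformly on that set, by the partial integrals of a single minorant. *)
Lemma near_large_minorants (mu : {measure set (borel X) -> \bar R})
    (C : set X) (t : \bar R) :
  compact_open_approximable mu -> compact C ->
  (forall x, C x -> t < potential k mu x) ->
  \forall h \near large_minorants, C `<=` [set x | t < \int[mu]_y h (x, y)].
Proof.
move=> amu /compact_near_coveringP cC Ct; apply: cC => x /Ct.
move=> /(local_product_minorant amu)[h hh near_h].
exists ([set x | t < \int[mu]_y h (x, y)],
        [set h' | product_minorant h' /\ forall z, h z <= h' z]).
  by split=> //=; exists h.
move=> [x' h'] [/= /lt_le_trans + [hh' le_h]]; apply.
apply: ge0_le_integral => //; try exact: product_minorant_section.
by move=> y _; have [_ + _] := hh; apply.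
Qed.

Definition mutual_energy (mu nu : {measure set (borel X) -> \bar R}) : \bar R :=
  \int[mu]_x potential k nu x.

Hypothesis k_sym : forall x y, k (x, y) = k (y, x).

(** Tonelli's theorem for a lower semicontinuous kernel and regular measures:
    if the left side were larger, so would be the integral of a simple [g]
    with compact levels strictly below the potential of [nu].  One minorant
    [h] of [k] has partial integrals at least [g] everywhere, and exchanging
    the integrals of [h] bounds that integral by the right side. *)
Lemma le_mutual_energyC (mu nu : {finite_measure set (borel X) -> \bar R}) :
  compact_open_approximable mu -> compact_open_approximable nu ->
  mutual_energy mu nu <= mutual_energy nu mu.
Proof.
move=> amu anu; rewrite leNgt; apply/negP.
move=> /(compact_level_nnsfun hX amu (potential_ge0 nu))[g [cg gU]].
apply/negP; rewrite -leNgt.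
have near_h v : v \in fset_set (range g) ->
    \forall h \near large_minorants, (0 < v)%R ->
      forall x, g x = v -> v%:E < \int[nu]_y h (x, y).
  move=> _; have [v0|v0] := boolP (0 < v)%R; last exact: nearW.
  have : \forall h \near large_minorants,
      g @^-1` [set v] `<=` [set x | v%:E < \int[nu]_y h (x, y)].
    apply: near_large_minorants => //; first exact: cg.
    by move=> x /= gxv; rewrite -gxv; apply: gU; rewrite gxv.
  by apply: filterS => h gvh _ x /gvh.
have nearM : \forall h \near large_minorants, product_minorant h.
  by exists (cst 0); [exact: product_minorant0|move=> h []].
have [h [gh hh]] := filter_ex (filterI (filter_bigI _ near_h) nearM).
have [mh h0 hk] := hh.
apply: (@le_trans _ _ (\int[mu]_x \int[nu]_y h (x, y))).
  apply: ge0_le_integral => //.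
  - by move=> x _; rewrite lee_fin.
  - exact/measurable_EFinP.
  - exact: measurable_fun_fubini_tonelli_F.
  - move=> x _; have : (0 <= g x)%R by []; rewrite le_eqVlt => /predU1P[<-|gx0].
      exact: integral_ge0.
    by apply: ltW; apply: (gh (g x)) => //=; rewrite in_fset_set ?inE.
rewrite fubini_tonelli//; apply: ge0_le_integral => //.
- by move=> y _; exact: integral_ge0.
- exact: measurable_fun_fubini_tonelli_G.
- exact: potential_borel.
- move=> y _; apply: ge0_le_integral => //.
  + exact: (measurableT_comp mh (pair2_measurable y)).
  + exact: kernel_section_borel.
  + by move=> x _; rewrite k_sym.
Qed.

Lemma mutual_energyC (mu nu : {finite_measure set (borel X) -> \bar R}) :
  compact_open_approximable mu -> compact_open_approximable nu ->
  mutual_energy mu nu = mutual_energy nu mu.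
Proof.
by move=> amu anu; apply/eqP; rewrite eq_le !le_mutual_energyC.
Qed.

End LowerSemicontinuousKernel.

(** * Comparison, conditioning and concentration of measures *)

Section MeasureComparison.
Set Implicit Arguments.
Unset Strict Implicit.
Context d {T : measurableType d} {R : realType}.
Implicit Types (mu nu : {measure set T -> \bar R}) (f : T -> \bar R).

Lemma le_integral_dominated mu nu (c : R) f : (0 < c)%R ->
  (forall A, measurable A -> nu A <= c%:E * mu A) ->
  measurable_fun setT f -> (forall x, 0 <= f x) ->
  \int[nu]_x f x <= c%:E * \int[mu]_x f x.
Proof.
move=> c0 numu mf f0.
have := @ge0_integral_mscale _ _ _ mu setT measurableT (NngNum (ltW c0)) f mf.
move=> /(_ (fun x _ => f0 x)) <-.
exact: ge0_le_measure_integral.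
Qed.

Lemma eq_integral_measureD (m1 m2 m3 m4 : {measure set T -> \bar R}) f :
  (forall A, measurable A -> m1 A + m2 A = m3 A + m4 A) ->
  measurable_fun setT f -> (forall x, 0 <= f x) ->
  \int[m1]_x f x + \int[m2]_x f x = \int[m3]_x f x + \int[m4]_x f x.
Proof.
move=> m1234 mf f0; rewrite -!ge0_integral_measure_add//.
apply: eq_measure_integral => A mA _.
by have := m1234 A mA; rewrite -!measure_addE.
Qed.

End MeasureComparison.

Section Conditioning.
Set Implicit Arguments.
Unset Strict Implicit.
Context d {T : measurableType d} {R : realType}.
Variables (mu : probability T R) (P : set T) (mP : measurable P).
Hypothesis muP : mu P != 0.

(** The last argument of [mnormalize] is its value when [P] is null. *)
Definition conditional : probability T R := mnormalize (mrestr mu mP) mu.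

Let r := fine (mu P).

Let muPE : mu P = r%:E.
Proof. by rewrite /r fineK// fin_num_measure. Qed.

Lemma conditional_mass_gt0 : (0 < r)%R.
Proof. by rewrite -lte_fin -muPE lt0e muP measure_ge0. Qed.

Let r_le1 : (r <= 1)%R.
Proof. by rewrite -lee_fin -muPE probability_le1. Qed.

Lemma conditionalE A : conditional A = r^-1%:E * mu (A `&` P).
Proof.
rewrite /conditional /= /mnormalize /= /mrestr setTI (negbTE muP) /=.
by rewrite muPE /= muleC.
Qed.

Lemma conditional_le A : measurable A -> conditional A <= r^-1%:E * mu A.
Proof.
move=> mA; rewrite conditionalE lee_pmul2l// ?lte_fin ?invr_gt0//; last first.
  exact: conditional_mass_gt0.
by apply: le_measure; rewrite ?inE//; exact: measurableI.
Qed.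

Lemma conditional_ge A : measurable A -> mu (A `&` P) <= conditional A.
Proof.
move=> mA; rewrite conditionalE -[leLHS]mul1e lee_pmul//.
by rewrite lee_fin invf_ge1// conditional_mass_gt0.
Qed.

Lemma conditional_disjoint A : A `&` P = set0 -> conditional A = 0.
Proof. by move=> AP; rewrite conditionalE AP measure0 mule0. Qed.

End Conditioning.

Section Concentration.
Set Implicit Arguments.
Unset Strict Implicit.
Context {R : realType} {X : ptopologicalType}.

(** [K] need not be Borel: its full mass is expressed by the outer measure. *)
Lemma M1_on_full (K : set X) (mu : probability (borel X) R) (B : set (borel X)) :
  M1_on K mu -> measurable B -> K `<=` B -> mu B = 1.
Proof.
move=> [_ _ muK] mB KB; apply/eqP; rewrite eq_le probability_le1//=.
rewrite -muK -(measurable_mu_extE mu mB).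
exact: le_mu_ext.
Qed.

Lemma measurable_level (f : borel X -> \bar R) c :
  measurable_fun setT f -> measurable [set x | f x = c].
Proof.
by move=> mf; have := mf measurableT _ (emeasurable_set1 c); rewrite setTI.
Qed.

Lemma integral_full (mu : probability (borel X) R) (f : borel X -> \bar R) c :
  measurable_fun setT f -> mu [set x | f x = c] = 1 -> \int[mu]_x f x = c.
Proof.
move=> mf muc.
have mB := measurable_level c mf.
rewrite (ae_eq_integral (cst c))//.
- by rewrite integral_cst// [X in _ * X]probability_setT mule1.
- exists (~` [set x | f x = c]); split.
  + exact: measurableC.
  + by rewrite [LHS](probability_setC mu mB) muc subee.
  + by move=> x /= h hc; apply: h.
Qed.

End Concentration.

(** * The energy of a difference of probability measures *)

Section Jordan.
Set Implicit Arguments.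
Unset Strict Implicit.
Context {R : realType} {X : ptopologicalType}.
Implicit Types mu nu : probability (borel X) R.

Lemma differenceE mu nu (A : set (borel X)) : difference mu nu A = mu A - nu A.
Proof. by []. Qed.

(** The balance [p + nu = n + mu] reduces integrals against the Jordan parts to
    integrals against [mu] and [nu] without subtracting, hence for functions
    whose integrals may be infinite; the two dominations carry regularity and
    finiteness of energies over to [p] and [n]. *)
Lemma difference_jordan mu nu :
  exists p n : {finite_measure set (borel X) -> \bar R},
  [/\ pos_part (difference mu nu) = p, neg_part (difference mu nu) = n,
      forall A, measurable A -> p A + nu A = n A + mu A,
      forall A, measurable A -> p A <= mu A &
      forall A, measurable A -> n A <= nu A].
Proof.
rewrite /pos_part /neg_part.
move: (projT1 _) (projT2 _) => P hP.
move: (projT1 _) (projT2 _) => N hPN.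
have [[mP posP] [mN negN] PNT PN0] := hPN.
have pE A : measurable A -> jordan_pos hPN A = mu (A `&` P) - nu (A `&` P).
  by move=> mA; rewrite jordan_posE cjordan_posE /crestr0 mem_set.
have nE A : measurable A -> jordan_neg hPN A = nu (A `&` N) - mu (A `&` N).
  move=> mA; rewrite jordan_negE cjordan_negE /crestr0 mem_set//.
  rewrite /crestr differenceE oppeB 1?addeC//.
  by rewrite fin_num_adde_defr// fin_num_measure//; exact: measurableI.
have fin (m : probability (borel X) R) A : measurable A -> m A \is a fin_num.
  by move=> mA; exact: fin_num_measure.
have splitPN (m : probability (borel X) R) A : measurable A ->
    m A = m (A `&` P) + m (A `&` N).
  move=> mA; rewrite -measureU//; last 3 first.
  - exact: measurableI.
  - exact: measurableI.
  - by rewrite setIACA PN0 setI0.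
  by rewrite -setIUr PNT setIT.
exists (jordan_pos hPN), (jordan_neg hPN); split=> //.
- move=> A mA; rewrite [X in X + _](pE A mA) [X in _ = X + _](nE A mA).
  rewrite (splitPN nu A)// (splitPN mu A)//.
  have mAP : measurable (A `&` P) by exact: measurableI.
  have mAN : measurable (A `&` N) by exact: measurableI.
  rewrite -(fineK (fin mu _ mAP)) -(fineK (fin nu _ mAP)).
  rewrite -(fineK (fin mu _ mAN)) -(fineK (fin nu _ mAN)) -!EFinB -!EFinD.
  by congr EFin; lra.
- move=> A mA; rewrite [leLHS](pE A mA); apply: (@le_trans _ _ (mu (A `&` P))).
    by rewrite leeBlDr ?leeDl// fin//; exact: measurableI.
  by apply: le_measure; rewrite ?inE//; exact: measurableI.
- move=> A mA; rewrite [leLHS](nE A mA); apply: (@le_trans _ _ (nu (A `&` N))).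
    by rewrite leeBlDr ?leeDl// fin//; exact: measurableI.
  by apply: le_measure; rewrite ?inE//; exact: measurableI.
Qed.
End Jordan.

Section SignedEnergy.
Set Implicit Arguments.
Unset Strict Implicit.
Context {R : realType} {X : ptopologicalType}.
Hypothesis hX : hausdorff_space X.
Variable k : X * X -> \bar R.
Hypothesis k_ge0 : forall z, 0 <= k z.
Hypothesis k_lsc : lower_semicontinuous k.
Hypothesis k_sym : forall x y, k (x, y) = k (y, x).
Implicit Types mu nu p n : {measure set (borel X) -> \bar R}.

Lemma mutual_energy_ge0 mu nu : 0 <= mutual_energy k mu nu.
Proof. by apply: integral_ge0 => x _; exact: potential_ge0. Qed.

Lemma le_mutual_energy mu nu mu' nu' (c c' : R) : (0 < c)%R -> (0 < c')%R ->
  (forall A, measurable A -> mu' A <= c%:E * mu A) ->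
  (forall A, measurable A -> nu' A <= c'%:E * nu A) ->
  compact_open_approximable nu ->
  mutual_energy k mu' nu' <= (c * c')%:E * mutual_energy k mu nu.
Proof.
move=> c0 c'0 mu'mu nu'nu anu.
have anu' := dominated_approximable hX c'0 nu'nu anu.
have U0 m x : 0 <= potential k m x by exact: potential_ge0.
have mU := potential_borel hX k_ge0 k_lsc anu.
have mU' := potential_borel hX k_ge0 k_lsc anu'.
apply: (@le_trans _ _ (\int[mu']_x (c'%:E * potential k nu x))).
  apply: ge0_le_integral => //; first exact: measurable_funeM.
  move=> x _; apply: le_integral_dominated => //.
  exact: kernel_section_borel.
rewrite ge0_integralZl//; last by rewrite lee_fin ltW.
rewrite mulrC EFinM -muleA lee_pmul2l ?lte_fin//.
exact: le_integral_dominated.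
Qed.

Lemma signed_energyE (s : {charge set (borel X) -> \bar R}) p n :
  pos_part s = p -> neg_part s = n ->
  signed_energy k s = \int[p]_x (potential k p x - potential k n x)
                      - \int[n]_x (potential k p x - potential k n x).
Proof.
move=> sp sn; rewrite /signed_energy /signed_integral sp sn.
suff -> : signed_potential k s = fun x => potential k p x - potential k n x by [].
apply/funext => y; rewrite /signed_potential /signed_integral sp sn.
by congr (_ - _); apply: eq_integral => x _; rewrite k_sym.
Qed.

Lemma potential_integrable p n : compact_open_approximable n ->
  mutual_energy k p n < +oo -> p.-integrable setT (potential k n).
Proof.
move=> an fin; apply/integrableP; split; first exact: potential_borel.
by under eq_integral do rewrite gee0_abs ?potential_ge0//.
Qed.

Lemma signed_energy_expand (s : {charge set (borel X) -> \bar R}) p n :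
  pos_part s = p -> neg_part s = n ->
  compact_open_approximable p -> compact_open_approximable n ->
  mutual_energy k p p < +oo -> mutual_energy k p n < +oo ->
  mutual_energy k n p < +oo -> mutual_energy k n n < +oo ->
  signed_energy k s = mutual_energy k p p - mutual_energy k p n
                      - (mutual_energy k n p - mutual_energy k n n).
Proof.
move=> sp sn ap an Epp Epn Enp Enn; rewrite (signed_energyE sp sn).
congr (_ - _).
- by apply: (integralB measurableT); exact: potential_integrable.
- by apply: (integralB measurableT); exact: potential_integrable.
Qed.

(** Integrating the signed potential [U p - U n] against [p], the positive part
    contributes at most the energy of [p], which is finite, while the negative
    part is infinite because [U n <= (U p - U n)^- + U p].  The resulting
    [-oo] absorbs whatever the integral against [n] is. *)
Lemma signed_energy_Ny (s : {charge set (borel X) -> \bar R}) p n :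
  pos_part s = p -> neg_part s = n ->
  compact_open_approximable p -> compact_open_approximable n ->
  mutual_energy k p p < +oo -> mutual_energy k p n = +oo ->
  signed_energy k s = -oo.
Proof.
move=> sp sn ap an Epp Epn; rewrite (signed_energyE sp sn).
set f := fun x => potential k p x - potential k n x.
have mUp := potential_borel hX k_ge0 k_lsc ap.
have mUn := potential_borel hX k_ge0 k_lsc an.
have mf : measurable_fun [set: borel X] f by exact: emeasurable_funB.
have U0 m x : 0 <= potential k m x by exact: potential_ge0.
suff -> : \int[p]_x f x = -oo by [].
rewrite integralE.
have -> : \int[p]_x f^\- x = +oo.
  apply/eqP; rewrite -leye_eq -(@leeD2rE _ (mutual_energy k p p)); last first.
    by rewrite ge0_fin_numE// mutual_energy_ge0.
  rewrite addye ?gt_eqF ?(lt_le_trans _ (mutual_energy_ge0 _ _))//.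
  rewrite -Epn /mutual_energy -ge0_integralD//; last exact: measurable_funeneg.
  apply: ge0_le_integral => //.
    by apply: emeasurable_funD => //; exact: measurable_funeneg.
  move=> x _; rewrite funenegE /f.
  case: (potential k p x) (U0 p x) (potential k n x) (U0 n x) => [r r0|_|//].
    by case=> [s' _|_|//] /=; rewrite ?lee_fin -?EFin_max -?EFinD ?lee_fin
      -?lerBlDr ?le_max ?opprB ?lexx.
  by move=> b _; rewrite addey ?leey// gt_eqF// (lt_le_trans ltNy0)// le_max lexx orbT.
have : \int[p]_x f^\+ x < +oo.
  apply: le_lt_trans Epp; apply: ge0_le_integral => //.
    exact: measurable_funepos.
  move=> x _; rewrite funeposE /f ge_max U0 andbT.
  case: (potential k p x) (U0 p x) (potential k n x) (U0 n x) => [r r0|_|//].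
    by case=> [s' s0|_|//] /=; rewrite ?leNye// lee_fin gerBl.
  by move=> b _; rewrite leey.
by case: (\int[p]_y f^\+ y).
Qed.

(** All the mutual energies of [mu], [nu] and the Jordan parts [p], [n] are
    finite by domination, so the identity follows linearly from additivity in
    each argument along [p + nu = n + mu] and from the symmetry of the mutual
    energy of [mu] and [nu]. *)
Lemma signed_energy_difference (mu nu : probability (borel X) R) :
  compact_open_approximable mu -> compact_open_approximable nu ->
  mutual_energy k mu mu < +oo -> mutual_energy k mu nu < +oo ->
  mutual_energy k nu nu < +oo ->
  signed_energy k (difference mu nu) =
    mutual_energy k mu mu + mutual_energy k nu nu
    - (mutual_energy k mu nu + mutual_energy k mu nu).
Proof.
move=> amu anu Emm Emn Enn.
have [p [n [sp sn pn pmu nnu]]] := difference_jordan mu nu.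
have pmu1 A : measurable A -> p A <= 1%:E * mu A.
  by move=> mA; rewrite mul1e; exact: pmu.
have nnu1 A : measurable A -> n A <= 1%:E * nu A.
  by move=> mA; rewrite mul1e; exact: nnu.
have le1 (m : {measure set (borel X) -> \bar R}) A : measurable A -> m A <= 1%:E * m A.
  by rewrite mul1e.
have ap := dominated_approximable hX ltr01 pmu1 amu.
have an := dominated_approximable hX ltr01 nnu1 anu.
have addl (m : {measure set (borel X) -> \bar R}) :
    compact_open_approximable m ->
    mutual_energy k p m + mutual_energy k nu m =
    mutual_energy k n m + mutual_energy k mu m.
  move=> am; apply: eq_integral_measureD => //; first exact: potential_borel.
  by move=> x; exact: potential_ge0.
have addr (m : {measure set (borel X) -> \bar R}) :
    mutual_energy k m p + mutual_energy k m nu =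
    mutual_energy k m n + mutual_energy k m mu.
  have U0 m' x : 0 <= potential k m' x by exact: potential_ge0.
  rewrite /mutual_energy -!ge0_integralD//; try exact: potential_borel.
  apply: eq_integral => x _; apply: eq_integral_measureD => //.
  exact: kernel_section_borel.
have fin (m m' : {measure set (borel X) -> \bar R})
    (M M' : probability (borel X) R) :
    (forall A, measurable A -> m A <= 1%:E * M A) ->
    (forall A, measurable A -> m' A <= 1%:E * M' A) ->
    compact_open_approximable M' -> mutual_energy k M M' < +oo ->
    exists r, mutual_energy k m m' = r%:E.
  move=> mM m'M' aM' EM.
  have := le_mutual_energy ltr01 ltr01 mM m'M' aM'; rewrite mulr1 mul1e.
  move=> /le_lt_trans /(_ EM); have := mutual_energy_ge0 m m'.
  by case: (mutual_energy k m m') => // r; exists r.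
have Enm : mutual_energy k nu mu < +oo by rewrite (mutual_energyC hX).
have [pp Epp] := fin p p mu mu pmu1 pmu1 amu Emm.
have [pn' Epn] := fin p n mu nu pmu1 nnu1 anu Emn.
have [np Enp] := fin n p nu mu nnu1 pmu1 amu Enm.
have [nn Enn'] := fin n n nu nu nnu1 nnu1 anu Enn.
have [up Eup] := fin nu p nu mu (le1 nu) pmu1 amu Enm.
have [mp Emp] := fin mu p mu mu (le1 mu) pmu1 amu Emm.
have [un Eun] := fin nu n nu nu (le1 nu) nnu1 anu Enn.
have [mn Emn'] := fin mu n mu nu (le1 mu) nnu1 anu Emn.
have [mm Emm'] := fin mu mu mu mu (le1 mu) (le1 mu) amu Emm.
have [mu' Emu] := fin mu nu mu nu (le1 mu) (le1 nu) anu Emn.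
have [uu Euu] := fin nu nu nu nu (le1 nu) (le1 nu) anu Enn.
rewrite (signed_energy_expand sp sn)// ?Epp ?Epn ?Enp ?Enn' ?ltry//.
have := addl p ap; have := addl n an; have := addr mu; have := addr nu.
have Eum : mutual_energy k nu mu = mu'%:E by rewrite (mutual_energyC hX).
rewrite Epp Epn Enp Enn' Eup Emp Eun Emn' Emm' Emu Euu Eum.
by rewrite -!EFinD => -[h1] [h2] [h3] [h4]; congr EFin; lra.
Qed.
End SignedEnergy.

(** * Consequences of positivity *)

Section Positivity.
Set Implicit Arguments.
Unset Strict Implicit.
Context {R : realType} {X : ptopologicalType}.
Hypothesis hX : hausdorff_space X.
Variable k : X * X -> \bar R.
Hypothesis k_ge0 : forall z, 0 <= k z.
Hypothesis k_lsc : lower_semicontinuous k.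
Hypothesis k_sym : forall x y, k (x, y) = k (y, x).
Implicit Types mu nu : probability (borel X) R.

Hypothesis k_pos : forall mu nu, M1 mu -> M1 nu ->
  0 <= signed_energy k (difference mu nu).

Lemma M1_approximable mu : M1 mu <-> compact_open_approximable mu.
Proof.
split; last exact: approximable_regular.
by apply: regular_approximable => // A mA; exact: fin_num_measure.
Qed.

(** For mutually singular measures the Jordan parts of the difference dominate
    [mu] and [nu], and an infinite mutual energy would then make the signed
    energy [-oo].  This is the only way in which positivity is exploited when
    energies are infinite: without singularity, the common part of [mu] and
    [nu] cancels inside the Jordan parts and infinite terms may disappear
    with it. *)
Lemma singular_mutual_energy mu nu (S : set (borel X)) : measurable S ->
  M1 mu -> M1 nu -> mu (~` S) = 0 -> nu S = 0 ->
  mutual_energy k mu mu < +oo -> mutual_energy k mu nu < +oo.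
Proof.
move=> mS Mmu Mnu muS nuS Emu; rewrite ltey; apply/eqP => Emn.
have amu := (M1_approximable mu).1 Mmu; have anu := (M1_approximable nu).1 Mnu.
have [p [n [sp sn pn pmu nnu]]] := difference_jordan mu nu.
have mI A : measurable A -> measurable (A `&` S) by move=> mA; exact: measurableI.
have mD A : measurable A -> measurable (A `\` S) by move=> mA; exact: measurableD.
have nu0 A : measurable A -> nu (A `&` S) = 0.
  by move=> mA; apply: subset_measure0 nuS => //; exact: mI.
have mu0 A : measurable A -> mu (A `\` S) = 0.
  move=> mA; apply: (subset_measure0 (B := ~` S)) => //; first exact: mD.
  exact: measurableC.
have mup A : measurable A -> mu A <= 1%:E * p A.
  move=> mA; rewrite mul1e.
  have -> : mu A = mu (A `&` S).
    by rewrite [LHS](measureDI mu mA mS) [X in X + _](mu0 _ mA) add0e.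
  apply: (@le_trans _ _ (p (A `&` S))).
    by have := pn _ (mI _ mA); rewrite nu0// adde0 => ->; rewrite leeDr.
  by apply: le_measure; rewrite ?inE//; exact: mI.
have nun A : measurable A -> nu A <= 1%:E * n A.
  move=> mA; rewrite mul1e.
  have -> : nu A = nu (A `\` S).
    by rewrite [LHS](measureDI nu mA mS) [X in _ + X](nu0 _ mA) adde0.
  apply: (@le_trans _ _ (n (A `\` S))).
    by have := pn _ (mD _ mA); rewrite mu0// adde0 => <-; rewrite leeDr.
  by apply: le_measure; rewrite ?inE//; exact: mD.
have pmu1 A : measurable A -> p A <= 1%:E * mu A.
  by move=> mA; rewrite mul1e; exact: pmu.
have nnu1 A : measurable A -> n A <= 1%:E * nu A.
  by move=> mA; rewrite mul1e; exact: nnu.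
have ap := dominated_approximable hX ltr01 pmu1 amu.
have an := dominated_approximable hX ltr01 nnu1 anu.
have := k_pos Mmu Mnu; rewrite (signed_energy_Ny hX k_ge0 k_lsc k_sym sp sn)//.
- have := le_mutual_energy hX k_ge0 k_lsc ltr01 ltr01 pmu1 pmu1 amu.
  by rewrite mulr1 mul1e => /le_lt_trans; apply.
- have := le_mutual_energy hX k_ge0 k_lsc ltr01 ltr01 mup nun an.
  by rewrite mulr1 mul1e Emn leye_eq => /eqP.
Qed.

(** On the positive set [P] of a Hahn decomposition of [mu - nu], [nu] is below
    [mu] and cannot account for an infinite potential on a measure of finite
    energy; on the negative set [N], [nu] is singular to the part of [mu]
    carried by [P], and positivity forbids it.  Both sets are charged, as
    otherwise [nu <= mu] throughout. *)
Lemma infinite_potential_infinite_energy mu nu : M1 mu -> M1 nu ->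
  mu [set x | potential k nu x = +oo] = 1 -> mutual_energy k mu mu = +oo.
Proof.
move=> Mmu Mnu full; apply/eqP; rewrite -leye_eq leNgt; apply/negP => Emu.
have amu := (M1_approximable mu).1 Mmu; have anu := (M1_approximable nu).1 Mnu.
have mUnu := potential_borel hX k_ge0 k_lsc anu.
have U0 m x : 0 <= potential k m x by exact: potential_ge0.
have Emn : mutual_energy k mu nu = +oo by exact: integral_full.
have not_le : ~ forall A, measurable A -> nu A <= 1%:E * mu A.
  move=> numu; have mumu A : measurable A -> mu A <= 1%:E * mu A by rewrite mul1e.
  have := le_mutual_energy hX k_ge0 k_lsc ltr01 ltr01 mumu numu amu.
  by rewrite mulr1 mul1e Emn leNgt Emu.
have [P [N [[mP posP] [mN negN] PNT PN0]]] := Hahn_decomposition (difference mu nu).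
have mIP A : measurable A -> measurable (A `&` P) by move=> mA; exact: measurableI.
have mIN A : measurable A -> measurable (A `&` N) by move=> mA; exact: measurableI.
have leP A : measurable A -> nu (A `&` P) <= mu (A `&` P).
  move=> mA; have := posP _ (mIP _ mA) (@subIsetr _ _ _).
  by rewrite differenceE sube_ge0// fin_num_measure//; exact: mIP.
have leN A : measurable A -> mu (A `&` N) <= nu (A `&` N).
  move=> mA; have := negN _ (mIN _ mA) (@subIsetr _ _ _).
  by rewrite differenceE sube_le0// fin_num_measure//; exact: mIN.
have splitPN (m : probability (borel X) R) A : measurable A ->
    m A = m (A `&` P) + m (A `&` N).
  move=> mA; rewrite -measureU//.
  - by rewrite -setIUr PNT setIT.
  - exact: mIP.
  - exact: mIN.
  - by rewrite setIACA PN0 setI0.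
(* If P were mu-null then mu <= nu, and comparing complements of probability
   measures gives nu <= mu. *)
have muP : mu P != 0.
  apply/eqP => muP0; apply: not_le => A mA; rewrite mul1e.
  have mCA : measurable (~` A) by exact: measurableC.
  have muCAP : mu (~` A `&` P) = 0.
    by apply: subset_measure0 muP0 => //; exact: mIP.
  have : mu (~` A) <= nu (~` A).
    rewrite (splitPN mu)// (splitPN nu)// muCAP add0e.
    by rewrite (le_trans (leN _ mCA))// leeDr.
  by rewrite !probability_setC// leeD2lE// leeN2.
have nuN : nu N != 0.
  apply/eqP => nuN0; apply: not_le => A mA; rewrite mul1e.
  have nuAN : nu (A `&` N) = 0.
    by apply: subset_measure0 nuN0 => //; exact: mIN.
  rewrite (splitPN nu A)// nuAN adde0.
  by apply: (le_trans (leP _ mA)); apply: le_measure; rewrite ?inE//; exact: mIP.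
pose alpha := conditional mu mP; pose beta := conditional nu mN.
have c0 : (0 < (fine (mu P))^-1)%R by rewrite invr_gt0 conditional_mass_gt0.
have alpha_mu A : measurable A -> alpha A <= (fine (mu P))^-1%:E * mu A.
  exact: conditional_le.
have aalpha := dominated_approximable hX c0 alpha_mu amu.
have abeta : compact_open_approximable beta.
  have b0 : (0 < (fine (nu N))^-1)%R by rewrite invr_gt0 conditional_mass_gt0.
  apply: (dominated_approximable hX b0 _ anu) => A mA.
  exact: conditional_le.
have Eaa : mutual_energy k alpha alpha < +oo.
  have := le_mutual_energy hX k_ge0 k_lsc c0 c0 alpha_mu alpha_mu amu.
  move=> /le_lt_trans; apply; rewrite lte_mul_pinfty// ?lee_fin ?ltW ?mulr_gt0//.
have Eam : mutual_energy k alpha mu < +oo.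
  have mumu A : measurable A -> mu A <= 1%:E * mu A by rewrite mul1e.
  have := le_mutual_energy hX k_ge0 k_lsc c0 ltr01 alpha_mu mumu amu.
  by move=> /le_lt_trans; apply; rewrite lte_mul_pinfty// lee_fin ltW ?mulr_gt0.
have Ean : mutual_energy k alpha nu = +oo.
  apply: integral_full => //.
  set B := (X in alpha X); have mB : measurable B by exact: measurable_level.
  have muB0 : mu (~` B) = 0 by rewrite probability_setC// full subee.
  have aB0 : alpha (~` B) = 0.
    apply/eqP; rewrite eq_le measure_ge0 andbT.
    have := alpha_mu _ (measurableC mB); rewrite muB0 mule0; exact.
  by rewrite -[B]setCK probability_setC ?aB0 ?sube0//; exact: measurableC.
have nu_le A : measurable A -> nu A <= 1%:E * measure_add mu beta A.
  move=> mA; rewrite mul1e measure_addE (splitPN nu)// leeD//.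
  - by apply: (le_trans (leP _ mA)); apply: le_measure; rewrite ?inE//; exact: mIP.
  - exact: conditional_ge.
have : mutual_energy k alpha beta < +oo.
  apply: (@singular_mutual_energy _ _ P) => //.
  - exact/M1_approximable.
  - exact/M1_approximable.
  - by apply: conditional_disjoint => //; rewrite setICl.
  - exact: conditional_disjoint.
have : mutual_energy k alpha nu <=
    mutual_energy k alpha mu + mutual_energy k alpha beta.
  rewrite /mutual_energy -ge0_integralD//; try exact: potential_borel.
  apply: ge0_le_integral => //.
    by apply: emeasurable_funD; exact: potential_borel.
  move=> x _; rewrite /potential -ge0_integral_measure_add//; last first.
    exact: kernel_section_borel.
  rewrite -[leRHS]mul1e; apply: le_integral_dominated => //.
  exact: kernel_section_borel.
rewrite Ean leye_eq => /eqP h hab.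
by have := lte_add_pinfty Eam hab; rewrite h.
Qed.

(** For infinite [c] the energy of [mu] is infinite as well.  For finite [c] the
    mutual energy of [mu] and [nu] and the energy of [nu] both equal [c], and
    the positive energy of the difference is the energy of [mu] minus [c]. *)
Lemma invariant_potential_le_energy mu nu c : M1 mu -> M1 nu ->
  mu [set x | potential k nu x = c] = 1 ->
  nu [set x | potential k nu x = c] = 1 ->
  c <= mutual_energy k mu mu.
Proof.
move=> Mmu Mnu muc nuc; have anu := (M1_approximable nu).1 Mnu.
have amu := (M1_approximable mu).1 Mmu.
have mUnu := potential_borel hX k_ge0 k_lsc anu.
have Emn : mutual_energy k mu nu = c by exact: integral_full.
have Enn : mutual_energy k nu nu = c by exact: integral_full.
have c0 : 0 <= c by rewrite -Enn; exact: mutual_energy_ge0.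
have [coo|cfin] := eqVneq c +oo.
  rewrite coo in muc *; rewrite leye_eq.
  by apply/eqP; exact: infinite_potential_infinite_energy Mnu muc.
have [->|Emm] := eqVneq (mutual_energy k mu mu) +oo; first exact: leey.
have := k_pos Mmu Mnu.
rewrite (signed_energy_difference hX k_ge0 k_lsc k_sym)// ?Emn ?Enn ?ltey//.
have := mutual_energy_ge0 k_ge0 mu mu.
move: Emm cfin c0; case: (mutual_energy k mu mu) => // e _.
case: (c) => // r _ _ _.
by rewrite -!EFinD !lee_fin => h; lra.
Qed.

End Positivity.

Theorem theorem5p4 (R : realType) (X : ptopologicalType)
    (lcX : locally_compact [set: X]) (hX : hausdorff_space X)
    (k : X * X -> \bar R)
    (k_ge0 : forall z, 0 <= k z)
    (k_lsc : lower_semicontinuous k)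
    (k_sym : forall x y, k (x, y) = k (y, x))
    (K L : set X) (K_neq0 : K !=set0) (KL : K `<=` L)
    (k_pos : forall mu nu : probability (borel X) R, M1 mu -> M1 nu ->
       signed_energy_defined k (difference mu nu) /\
       0 <= signed_energy k (difference mu nu))
    (a : \bar R) (aKL : average_set k K L = [set a])
    (mu0 : probability (borel X) R) (mu0K : M1_on K mu0)
    (mu0L : invariant_on k L mu0) :
  a = wiener_energy k K /\
  forall x, L x -> potential k mu0 x = wiener_energy k K.
Proof.
have [c mu0c] := mu0L.
have [x0 Kx0] := K_neq0.
have Mmu0 : M1 mu0 by have [] := mu0K.
have amu0 := (M1_approximable hX mu0).1 Mmu0.
have mU := potential_borel hX k_ge0 k_lsc amu0.
have potL : potential k mu0 @` L = [set c].
  apply/seteqP; split=> [_ [x Lx <-]|_ ->] /=; first exact: mu0c.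
  by exists x0; [exact: KL|exact/mu0c/KL].
have ac : a = c.
  have : average_set k K L a by rewrite aKL.
  move=> [_ /(_ mu0 mu0K)] /=; rewrite potL ereal_inf1 ereal_sup1.
  by move=> /le_anti.
have full (mu : probability (borel X) R) :
    M1_on K mu -> mu [set x | potential k mu0 x = c] = 1.
  move=> muK; apply: (M1_on_full muK) => [|x Kx]; last exact/mu0c/KL.
  exact: measurable_level.
have k_pos' (mu nu : probability (borel X) R) : M1 mu -> M1 nu ->
    0 <= signed_energy k (difference mu nu).
  by move=> Mmu Mnu; have [] := k_pos mu nu Mmu Mnu.
have wc : wiener_energy k K = c.
  apply/eqP; rewrite eq_le; apply/andP; split.
    apply: ereal_inf_lbound; exists mu0 => //.
    by apply: integral_full => //; exact: full.
  apply: le_ereal_inf_tmp => _ [mu muK <-].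
  have [Mmu _ _] := muK.
  exact: (invariant_potential_le_energy hX k_ge0 k_lsc k_sym k_pos' Mmu Mmu0
            (full _ muK) (full _ mu0K)).
by rewrite wc; split.
Qed.
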